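(* Let $\mathcal{B},\mathcal{I},\mathcal{M}$ be categories, let $j_2:\mathcal{B}\to\mathcal{I}$, $j_1:\mathcal{I}\to\mathcal{M}$, $\pi:\mathcal{M}\to\mathcal{I}$ be functors with $\pi\circ j_1=\mathrm{Id}_{\mathcal{I}}$, let $\gamma:\mathcal{M}\to\mathbf{Set}$ be a functor, and let $\mathcal{N}_{\mathcal{B}}$ be a nullity structure on $\mathcal{B}$ (over $\gamma j_1 j_2$). Let $\mathcal{N}^{(\mathcal{M})}$ be the nullity constructed from these data for $\mathcal{M}$. Then $\mathcal{N}^{(\mathcal{M})}$ is invariant under the endomorphisms of $\mathcal{M}$: for every object $V$ of $\mathcal{M}$, every morphism $h:V\to V$ in $\mathcal{M}$ and every $S\in\mathcal{N}^{(\mathcal{M})}(V)$, one has $\gamma(h)(S)\in\mathcal{N}^{(\mathcal{M})}(V)$.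
   Context: A nullity structure on a set $A$ is a down-set of the power set $2^A$, i.e. a collection of subsets of $A$ closed under passing to subsets. The category $\mathrm{Nullity}$ has objects $(A,\mathcal{N}_A)$ with $A$ a set and $\mathcal{N}_A$ a nullity structure on $A$; a morphism $(A,\mathcal{N}_A)\to(B,\mathcal{N}_B)$ is a map $u:A\to B$ with $u(S)\in\mathcal{N}_B$ for all $S\in\mathcal{N}_A$. A nullity structure on a category $\mathcal{X}$ equipped with a functor $\delta:\mathcal{X}\to\mathbf{Set}$ is a functor $\mathcal{X}\to\mathrm{Nullity}$ whose composite with the forgetful functor $\mathrm{Nullity}\to\mathbf{Set}$ is $\delta$; equivalently, a choice of a down-set $\mathcal{N}(x)\subseteq 2^{\delta(x)}$ for each object $x$ such that $\delta(u)(S)\in\mathcal{N}(x')$ for every $u:x\to x'$ and $S\in\mathcal{N}(x)$. The nullity structure $\mathcal{N}_{\mathcal{B}}$ is one on $\mathcal{B}$ with respect to $\gamma j_1 j_2:\mathcal{B}\to\mathbf{Set}$. The comma category $(j_1j_2\downarrow\mathcal{M})$ has objects $(b,V,T)$ with $b\in\mathcal{B}$, $V\in\mathcal{M}$, $T:j_1j_2(b)\to V$ in $\mathcal{M}$. The comma category $(j_2\downarrow\pi)$ has objects (called probes of $V$) $(b,V,\varphi)$ with $b\in\mathcal{B}$, $V\in\mathcal{M}$, $\varphi:j_2(b)\to\pi(V)$ in $\mathcal{I}$. Morphisms are pairs $(f,g)$, $f$ in $\mathcal{B}$, $g$ in $\mathcal{M}$, making the evident square commute. The functor $\pi_*:(j_1j_2\downarrow\mathcal{M})\to(j_2\downarrow\pi)$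 sends $(b,V,T)$ to $(b,V,\pi(T))$ and the functor $\bot_2:(j_2\downarrow\pi)\to\mathcal{M}$ sends $(b,V,\varphi)$ to $V$. Construction of $\mathcal{N}^{(\mathcal{M})}$. (1) For $(b,V,T)\in(j_1j_2\downarrow\mathcal{M})$ put $F(b,V,T)=\{S\subseteq\gamma(V):\gamma(T)^{-1}(S)\in\mathcal{N}_{\mathcal{B}}(b)\}$. (2) The probed nullity $P$ is the right Kan extension of $F$ along $\pi_*$ (taken over $\mathbf{Set}$, i.e. with underlying sets $\gamma(V)$ and comparison maps the identity on underlying sets); pointwise, $P(b,V,\varphi)$ is the set of all $S\subseteq\gamma(V)$ such that for every $(b',V',T)\in(j_1j_2\downarrow\mathcal{M})$ and every morphism $(f,g):(b,V,\varphi)\to\pi_*(b',V',T)$ in $(j_2\downarrow\pi)$ (that is, $f:b\to b'$, $g:V\to V'$ with $\pi(T)\circ j_2(f)=\pi(g)\circ\varphi$) one has $\gamma(g)(S)\in F(b',V',T)$. (3) $\mathcal{N}^{(\mathcal{M})}$ is the left Kan extension of $P$ along $\bot_2$ (again over $\mathbf{Set}$); pointwise, $\mathcal{N}^{(\mathcal{M})}(V)=\bigcup P(b,V,\varphi)$, the union over all probes $(b,V,\varphi)$ of $V$. *)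

(* Defs.v *)
From mathcomp Require Import all_boot.
From mathcomp Require Import boolp classical_sets.

Set Implicit Arguments.
Unset Strict Implicit.
Unset Printing Implicit Defensive.

Local Open Scope classical_set_scope.

Record category := Category {
  obj :> Type;
  hom : obj -> obj -> Type;
  idm : forall a, hom a a;
  compm : forall a b c, hom b c -> hom a b -> hom a c;
  compm1l : forall a b (f : hom a b), compm (idm b) f = f;
  compm1r : forall a b (f : hom a b), compm f (idm a) = f;
  compmA : forall a b c d (h : hom c d) (g : hom b c) (f : hom a b),
    compm h (compm g f) = compm (compm h g) f }.

Arguments hom {c} a b : rename.
Arguments idm {c} a : rename.
Arguments compm {c a b d} g f : rename.

Declare Scope category_scope.
Notation "g '\c' f" := (compm g f)
  (at level 40, left associativity) : category_scope.
Local Open Scope category_scope.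

Record functor (C D : category) := Functor {
  fobj :> C -> D;
  fhom : forall a b : C, hom a b -> hom (fobj a) (fobj b);
  fhom1 : forall a, fhom (idm a) = idm (fobj a);
  fhomM : forall a b c (g : hom b c) (f : hom a b),
    fhom (g \c f) = fhom g \c fhom f }.

Arguments fhom {C D} F {a b} f : rename.

Definition functor_id (C : category) : functor C C :=
  @Functor C C (fun a => a) (fun _ _ f => f)
    (fun _ => erefl) (fun _ _ _ _ _ => erefl).

Section FunctorComp.
Context (C D E : category) (G : functor D E) (F : functor C D).

Lemma functor_comp1 (a : C) : fhom G (fhom F (idm a)) = idm (G (F a)).
Proof. by rewrite !fhom1. Qed.

Lemma functor_compM (a b c : C) (g : hom b c) (f : hom a b) :
  fhom G (fhom F (g \c f)) = fhom G (fhom F g) \c fhom G (fhom F f).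
Proof. by rewrite !fhomM. Qed.

Definition functor_comp : functor C E :=
  @Functor C E (fun a => G (F a)) (fun _ _ f => fhom G (fhom F f))
    functor_comp1 functor_compM.

End FunctorComp.

Notation "G '\oF' F" := (functor_comp G F)
  (at level 50, left associativity) : category_scope.

Definition SetCat : category :=
  @Category Type (fun A B => A -> B) (fun _ x => x) (fun _ _ _ g f x => g (f x))
    (fun _ _ _ => erefl) (fun _ _ _ => erefl) (fun _ _ _ _ _ _ _ => erefl).

(* Comma category (F | G). *)
Section Comma.
Context (A B C : category) (F : functor A C) (G : functor B C).

Record comma_obj := CommaObj {
  csrc : A;
  ctgt : B;
  carr : hom (F csrc) (G ctgt) }.

Record comma_hom (x y : comma_obj) := CommaHom {
  hsrc : hom (csrc x) (csrc y);
  htgt : hom (ctgt x) (ctgt y);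
  hsquare : carr y \c fhom F hsrc = fhom G htgt \c carr x }.

Lemma comma_hom_eq x y (m n : comma_hom x y) :
  hsrc m = hsrc n -> htgt m = htgt n -> m = n.
Proof.
case: m n => [f g e] [f' g' e'] /= ef eg; subst f' g'.
by rewrite (Prop_irrelevance e e').
Qed.

Lemma comma_id_square x :
  carr x \c fhom F (idm (csrc x)) = fhom G (idm (ctgt x)) \c carr x.
Proof. by rewrite !fhom1 compm1l compm1r. Qed.

Definition comma_id x : comma_hom x x := CommaHom (comma_id_square x).

Lemma comma_comp_square x y z (n : comma_hom y z) (m : comma_hom x y) :
  carr z \c fhom F (hsrc n \c hsrc m) = fhom G (htgt n \c htgt m) \c carr x.
Proof. by rewrite !fhomM compmA hsquare -compmA hsquare compmA. Qed.

Definition comma_comp x y z (n : comma_hom y z) (m : comma_hom x y) :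
  comma_hom x z := CommaHom (comma_comp_square n m).

Lemma comma_comp1l x y (m : comma_hom x y) : comma_comp (comma_id y) m = m.
Proof. by apply: comma_hom_eq; rewrite /= compm1l. Qed.

Lemma comma_comp1r x y (m : comma_hom x y) : comma_comp m (comma_id x) = m.
Proof. by apply: comma_hom_eq; rewrite /= compm1r. Qed.

Lemma comma_compA x y z t
    (p : comma_hom z t) (n : comma_hom y z) (m : comma_hom x y) :
  comma_comp p (comma_comp n m) = comma_comp (comma_comp p n) m.
Proof. by apply: comma_hom_eq; rewrite /= compmA. Qed.

Definition comma : category :=
  Category comma_comp1l comma_comp1r comma_compA.

Definition comma_tgt : functor comma B :=
  @Functor comma B ctgt (fun _ _ m => htgt m)
    (fun _ => erefl) (fun _ _ _ _ _ => erefl).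

End Comma.

Definition nullity_on (A : Type) (N : set (set A)) : Prop :=
  forall S S' : set A, S' `<=` S -> N S -> N S'.

(* Nullity structure on [X] with respect to [d] : a lift of [d] along the
   forgetful functor from sets with a nullity structure to sets. *)
Record nullity_structure (X : category) (d : functor X SetCat) := Nullity {
  nullity :> forall x : X, set (set (d x));
  nullity_down : forall x, nullity_on (@nullity x);
  nullity_image : forall (x x' : X) (u : hom x x') (S : set (d x)),
    @nullity x S -> @nullity x' (fhom d u @` S) }.

Arguments nullity {X d} N x _ : rename.

Section HomTransport.
Context (C D : category).

(* Equality of functors is strict, so [hom (K a) y] and [hom (L a) y] are only
   propositionally equal types; this is the resulting identification. *)
Definition hom_transport (K L : functor C D) (e : K = L) (a : C) (y : D)
  (t : hom (K a) y) : hom (L a) y :=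
  eq_rect K (fun H : functor C D => hom (H a) y) t L e.

Lemma hom_transport_square (K L : functor C D) (e : K = L) (a a' : C) (y y' : D)
    (t : hom (K a) y) (t' : hom (K a') y') (f : hom a a') (g : hom y y') :
  t' \c fhom K f = g \c t ->
  hom_transport e t' \c fhom L f = g \c hom_transport e t.
Proof. by case: L / e. Qed.

End HomTransport.

Section Construction.
Context (B I M : category).
Context (j2 : functor B I) (j1 : functor I M) (pi : functor M I).
Context (pij1 : pi \oF j1 = functor_id I).
Context (gamma : functor M SetCat).
Context (NB : nullity_structure (gamma \oF (j1 \oF j2))).

Definition comma_j1j2 : category := comma (j1 \oF j2) (functor_id M).

Definition probe : category := comma j2 pi.

Definition pi_star_obj (x : comma_j1j2) : probe :=
  CommaObj (F := j2) (G := pi) (csrc := csrc x) (ctgt := ctgt x)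
    (hom_transport pij1 (fhom pi (carr x) : hom ((pi \oF j1) (j2 (csrc x))) _)).

Lemma pi_star_square (x y : comma_j1j2) (m : hom x y) :
  carr (pi_star_obj y) \c fhom j2 (hsrc m) =
  fhom pi (htgt m) \c carr (pi_star_obj x).
Proof.
apply: (hom_transport_square pij1 (f := fhom j2 (hsrc m))).
by rewrite /= -!fhomM; congr (fhom pi _); exact: (hsquare m).
Qed.

Definition pi_star_hom (x y : comma_j1j2) (m : hom x y) :
  hom (pi_star_obj x) (pi_star_obj y) :=
  @CommaHom B M I j2 pi (pi_star_obj x) (pi_star_obj y)
    (hsrc m) (htgt m) (pi_star_square m).

Lemma pi_star1 (x : comma_j1j2) : pi_star_hom (idm x) = idm (pi_star_obj x).
Proof. exact: comma_hom_eq. Qed.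

Lemma pi_starM (x y z : comma_j1j2) (n : hom y z) (m : hom x y) :
  pi_star_hom (n \c m) = pi_star_hom n \c pi_star_hom m.
Proof. exact: comma_hom_eq. Qed.

Definition pi_star : functor comma_j1j2 probe :=
  Functor pi_star1 pi_starM.

Definition bot2 : functor probe M := comma_tgt j2 pi.

Definition target_nullity (x : comma_j1j2) : set (set (gamma (ctgt x))) :=
  [set S | NB (csrc x) (fhom gamma (carr x) @^-1` S)].

Arguments target_nullity x _ : clear implicits.

(* [target_nullity] need not be stable under images along morphisms of
   [comma_j1j2], so its right Kan extension over sets along [pi_star] is given
   by the pointwise formula: this is the largest nullity structure on [probe]
   (with respect to [gamma \oF bot2]) whose restriction along [pi_star] is
   contained in [target_nullity]. *)
Definition probed_nullity (p : probe) : set (set (gamma (bot2 p))) :=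
  [set S | forall (x : comma_j1j2) (m : hom p (pi_star x)),
     target_nullity x (fhom gamma (fhom bot2 m) @` S)].

Arguments probed_nullity p _ : clear implicits.

(* Pointwise left Kan extension over sets of [probed_nullity] along [bot2] :
   the union over all probes of [V]. *)
Definition constructed_nullity (V : M) : set (set (gamma V)) :=
  \bigcup_(q in [set: {b : B & hom (j2 b) (pi V)}])
    (probed_nullity (CommaObj (F := j2) (G := pi) (tagged q))
       : set (set (gamma V))).

End Construction.

Arguments pi_star {B I M j2 j1 pi} pij1.
Arguments target_nullity {B I M j2 j1 gamma} NB x _.
Arguments probed_nullity {B I M j2 j1 pi} pij1 {gamma} NB p _.
Arguments constructed_nullity {B I M j2 j1 pi} pij1 {gamma} NB V _.

(* Main.v *)
Require Import Defs.
From mathcomp Require Import all_boot.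
From mathcomp Require Import boolp classical_sets.

Local Open Scope classical_set_scope.
Local Open Scope category_scope.

(** A probe [phi] of [V] can be pushed forward along any [g : V -> W], giving
    the probe [fhom pi g \c phi] of [W] with the same source [b], and the pair
    [(idm b, g)] is a morphism between these two probes.  The condition that
    defines the probed nullity quantifies over all morphisms out of a probe, so
    precomposition carries it along morphisms of probes
    ([probed_nullity_image]).  Hence if [S] is null for [phi], its image under
    [g] is null for the pushed-forward probe: the union over all probes is
    functorial on the whole of [M] ([constructed_nullity_image]), and
    invariance under endomorphisms is the case [W = V]. *)

Section Functoriality.
Context (B I M : category).
Context (j2 : functor B I) (j1 : functor I M) (pi : functor M I).
Context (pij1 : pi \oF j1 = functor_id I).
Context (gamma : functor M SetCat).
Context (NB : nullity_structure (gamma \oF (j1 \oF j2))).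

Lemma fhom_set_comp_image (C : category) (d : functor C SetCat) (a b c : C)
    (v : hom b c) (u : hom a b) (S : set (d a)) :
  fhom d (v \c u) @` S = fhom d v @` (fhom d u @` S).
Proof. by rewrite image_comp fhomM. Qed.

(** Each condition on the image of [S] given by some [m : q -> pi_star x] is the
    condition on [S] itself given by [m \c n : p -> pi_star x]. *)
Lemma probed_nullity_image (p q : probe j2 pi) (n : hom p q)
    (S : set (gamma (bot2 j2 pi p))) :
  probed_nullity pij1 NB p S ->
  probed_nullity pij1 NB q (fhom gamma (fhom (bot2 j2 pi) n) @` S).
Proof.
move=> PS x m; rewrite -fhom_set_comp_image -fhomM.
exact: PS x (m \c n).
Qed.

Lemma probe_push_square (b : B) (V W : M) (phi : hom (j2 b) (pi V))
    (g : hom V W) :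
  (fhom pi g \c phi) \c fhom j2 (idm b) = fhom pi g \c phi.
Proof. by rewrite fhom1 compm1r. Qed.

Definition probe_push (b : B) (V W : M) (phi : hom (j2 b) (pi V))
    (g : hom V W) :
  comma_hom (CommaObj phi) (CommaObj (fhom pi g \c phi)) :=
  @CommaHom B M I j2 pi (CommaObj phi) (CommaObj (fhom pi g \c phi))
    (idm b) g (probe_push_square b V W phi g).

Lemma constructed_nullity_image (V W : M) (g : hom V W) (S : set (gamma V)) :
  constructed_nullity pij1 NB V S ->
  constructed_nullity pij1 NB W (fhom gamma g @` S).
Proof.
case=> -[b phi] _ PS.
exists (existT _ b (fhom pi g \c phi)) => //.
exact: (probed_nullity_image _ _ (probe_push b V W phi g)) PS.
Qed.

End Functoriality.

Theorem theorem1 (B I M : category)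
    (j2 : functor B I) (j1 : functor I M) (pi : functor M I)
    (pij1 : pi \oF j1 = functor_id I)
    (gamma : functor M SetCat)
    (NB : nullity_structure (gamma \oF (j1 \oF j2)))
    (V : M) (h : hom V V) (S : set (gamma V)) :
  constructed_nullity pij1 NB V S ->
  constructed_nullity pij1 NB V (fhom gamma h @` S).
Proof. exact: constructed_nullity_image. Qed.
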